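(* There exists a quadratic word equation whose length abstraction is not Presburger-definable.
   Context: Fix disjoint sets $A$ (a finite alphabet of constants) and $V$ (variables). A word equation is an expression $L = R$ with $L,R \in (A\cup V)^*$. A solution is a homomorphism $\sigma : (A\cup V)^* \to A^*$ fixing every constant $a\in A$ such that $\sigma(L)=\sigma(R)$. The equation is quadratic if each variable occurs at most twice in $L R$ in total. If $x_1,\dots,x_k$ (in a fixed order) are the variables of the equation $E$, its length abstraction is $\mathrm{Len}(E)=\{(|\sigma(x_1)|,\dots,|\sigma(x_k)|) : \sigma \text{ a solution of } E\}\subseteq \mathbb{N}^k$. A set $S\subseteq\mathbb{N}^k$ is Presburger-definable if it is definable by a first-order formula of Presburger arithmetic (the first-order theory of the natural numbers with addition and order). *)

(* Defs.v *)
From mathcomp Require Import all_boot.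

Set Implicit Arguments.
Unset Strict Implicit.
Unset Printing Implicit Defensive.

Section WordEquations.

Variables (A : finType) (V : eqType).

(* Words over the disjoint union of the constants A and the variables V. *)
Definition pattern := seq (A + V)%type.

Record word_equation := WordEquation { lhs : pattern; rhs : pattern }.

Definition solution (E : word_equation) (sigma : pattern -> seq A) : Prop :=
  [/\ sigma [::] = [::],
      forall u v, sigma (u ++ v) = sigma u ++ sigma v,
      forall a : A, sigma [:: inl a] = [:: a]
    & sigma (lhs E) = sigma (rhs E)].

Definition quadratic (E : word_equation) : Prop :=
  forall x : V, count_mem (inr x : (A + V)%type) (lhs E ++ rhs E) <= 2.

(* The distinct variables occurring in E. The order is the one chosen by
   undup, i.e., the order of last occurrences in lhs E ++ rhs E. *)
Definition variables (E : word_equation) : seq V :=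
  undup (pmap (fun s : (A + V)%type => if s is inr x then Some x else None)
              (lhs E ++ rhs E)).

Definition Len (E : word_equation) (v : (size (variables E)).-tuple nat) : Prop :=
  exists2 sigma : pattern -> seq A, solution E sigma
    & v = map_tuple (fun x => size (sigma [:: inr x]))
                    (in_tuple (variables E)).

End WordEquations.

Arguments Len {A V} E v.

(* Presburger formulas in well-scoped de Bruijn form: n bounds the free
   variables, and a quantifier binds variable 0 of its body. *)
Inductive pterm (n : nat) : Type :=
| PVar of 'I_n
| PZero
| POne
| PAdd of pterm n & pterm n.

Inductive pformula : nat -> Type :=
| PEq n of pterm n & pterm n : pformula n
| PLe n of pterm n & pterm n : pformula n
| PNot n of pformula n : pformula n
| PAnd n of pformula n & pformula n : pformula n
| POr n of pformula n & pformula n : pformula n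
| PImp n of pformula n & pformula n : pformula n
| PExists n of pformula n.+1 : pformula n
| PForall n of pformula n.+1 : pformula n.

Fixpoint peval n (v : n.-tuple nat) (t : pterm n) : nat :=
  match t with
  | PVar i => tnth v i
  | PZero => 0
  | POne => 1
  | PAdd t1 t2 => peval v t1 + peval v t2
  end.

Fixpoint pholds n (phi : pformula n) : n.-tuple nat -> Prop :=
  match phi in pformula m return m.-tuple nat -> Prop with
  | PEq _ t1 t2 => fun v => peval v t1 = peval v t2
  | PLe _ t1 t2 => fun v => peval v t1 <= peval v t2
  | PNot _ f => fun v => ~ pholds f v
  | PAnd _ f g => fun v => pholds f v /\ pholds g v
  | POr _ f g => fun v => pholds f v \/ pholds g v
  | PImp _ f g => fun v => pholds f v -> pholds g v
  | PExists _ f => fun v => exists m : nat, pholds f (cons_tuple m v)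
  | PForall _ f => fun v => forall m : nat, pholds f (cons_tuple m v)
  end.

Definition presburger_definable k (S : k.-tuple nat -> Prop) : Prop :=
  exists phi : pformula k, forall v : k.-tuple nat, S v <-> pholds phi v.

(* Main.v *)
(** The equation is x a b y = y b a x. Cancelling the shorter variable against
    the longer one turns a solution (x, y) into a solution (z, y) with
    x = y b a z: this is a step of Euclid's algorithm on (|x| + 2, |y| + 2),
    so the lengths of solutions are the pairs (m, n) with m + 2 and n + 2
    coprime. On the other hand (Büchi), every Presburger-definable S is
    2-automatic: the sets {v | S (2^n v + r)} with r < 2^n are finitely many.
    For the coprimality relation they are infinitely many: for an odd prime
    p <= 2^n and r = p - 2, such a set contains (0, x) if and only if p does
    not divide x, so it determines p. *)
Require Import Defs.
From mathcomp Require Import all_boot zify.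

Set Implicit Arguments.
Unset Strict Implicit.
Unset Printing Implicit Defensive.

(** * Closure properties of 2-automatic sets *)

Definition append_bits k (e : k.-tuple bool) (v : k.-tuple nat) :
    k.-tuple nat :=
  map_tuple (fun p : bool * nat => p.1 + p.2.*2) (zip_tuple e v).

Lemma tnth_append_bits k (e : k.-tuple bool) v i :
  tnth (append_bits e v) i = tnth e i + (tnth v i).*2.
Proof.
rewrite tnth_map.
by rewrite (tnth_nth (false, 0)) /= nth_zip ?size_tuple // -!tnth_nth.
Qed.

Lemma append_bits_cons k b (e : k.-tuple bool) m v :
  append_bits (cons_tuple b e) (cons_tuple m v) =
  cons_tuple (b + m.*2) (append_bits e v).
Proof. exact: val_inj. Qed.

(* Each state q stands for the set F q, and reading the least significant bits
   e in state q leads to the state standing for {v | F q (2 v + e)}. *)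
Definition automatic k (S : k.-tuple nat -> Prop) : Prop :=
  exists (Q : finType) (F : Q -> k.-tuple nat -> Prop)
         (step : k.-tuple bool -> Q -> Q) (q0 : Q),
    (forall v, S v <-> F q0 v) /\
    (forall e q v, F q (append_bits e v) <-> F (step e q) v).

Lemma automatic_ext k (S T : k.-tuple nat -> Prop) :
  (forall v, T v <-> S v) -> automatic S -> automatic T.
Proof.
move=> eqTS [Q [F [step [q0 [F0 Fstep]]]]].
exists Q, F, step, q0; split=> // v.
by split=> [/eqTS/F0 | /F0/eqTS].
Qed.

Lemma automatic_not k (S : k.-tuple nat -> Prop) :
  automatic S -> automatic (fun v => ~ S v).
Proof.
move=> [Q [F [step [q0 [F0 Fstep]]]]].
exists Q, (fun q v => ~ F q v), step, q0; split=> [v | e q v].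
  by have := F0 v; tauto.
by have := Fstep e q v; tauto.
Qed.

Lemma automatic_op2 (op : Prop -> Prop -> Prop) k (S T : k.-tuple nat -> Prop) :
  (forall P P' R R', (P <-> P') -> (R <-> R') -> (op P R <-> op P' R')) ->
  automatic S -> automatic T -> automatic (fun v => op (S v) (T v)).
Proof.
move=> op_iff [Q [F [step [q0 [F0 Fstep]]]]] [Q' [F' [step' [q0' [F0' Fstep']]]]].
exists (Q * Q')%type, (fun q v => op (F q.1 v) (F' q.2 v)),
  (fun e q => (step e q.1, step' e q.2)), (q0, q0').
by split=> [v | e q v]; apply: op_iff.
Qed.

Section Projection.

Variables (k : nat) (Q : finType) (step : k.+1.-tuple bool -> Q -> Q).

(** Subset construction: the bit of the quantified variable is not part of the input, so both of its
    values are followed. *)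
Definition step_proj (e : k.-tuple bool) (G : {set Q}) : {set Q} :=
  [set step (cons_tuple b e) q | b : bool, q : Q in G].

Lemma step_projP e (G : {set Q}) q :
  reflect (exists b q', q' \in G /\ q = step (cons_tuple b e) q')
          (q \in step_proj e G).
Proof.
apply: (iffP imset2P) => [[b q' _ q'G ->] | [b [q' [q'G ->]]]].
  by exists b, q'.
by exists b q'.
Qed.

End Projection.

(** A set of states is read as the disjunction of its members; the bit to guess is the parity of the
    witness [m], and [m./2] is the next witness. *)
Lemma automatic_exists k (S : k.+1.-tuple nat -> Prop) :
  automatic S -> automatic (fun v => exists m, S (cons_tuple m v)).
Proof.
move=> [Q [F [step [q0 [F0 Fstep]]]]].
exists {set Q}, (fun (G : {set Q}) v => exists m q, q \in G /\ F q (cons_tuple m v)),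
  (step_proj step), [set q0]; split=> [v | e G v].
  split=> [[m /F0 Fm] | [m [q [/set1P-> /F0 Sm]]]]; last by exists m.
  by exists m, q0; rewrite set11.
split=> [[m [q [qG]]] | [m [_ [/step_projP[b [q [qG ->]]]]]]].
  rewrite -[m]odd_double_half -append_bits_cons => /Fstep Fm.
  exists m./2, (step (cons_tuple (odd m) e) q); split=> //.
  by apply/step_projP; exists (odd m), q.
by move/Fstep; rewrite append_bits_cons => Fm; exists (b + m.*2), q.
Qed.

(** The same subset construction, with a set of states read as a conjunction; a detour through
    negation and [automatic_exists] would need classical logic. *)
Lemma automatic_forall k (S : k.+1.-tuple nat -> Prop) :
  automatic S -> automatic (fun v => forall m, S (cons_tuple m v)).
Proof.
move=> [Q [F [step [q0 [F0 Fstep]]]]].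
exists {set Q}, (fun (G : {set Q}) v => forall m q, q \in G -> F q (cons_tuple m v)),
  (step_proj step), [set q0]; split=> [v | e G v].
  split=> [Sv m q /set1P-> | Fv m]; first exact/F0.
  by apply/F0/Fv; rewrite set11.
split=> [Fv m _ /step_projP[b [q [qG ->]]] | Fv m q qG].
  by apply/Fstep; rewrite append_bits_cons; apply: Fv.
rewrite -[m]odd_double_half -append_bits_cons; apply/Fstep/Fv.
by apply/step_projP; exists (odd m), q.
Qed.

(** * Automata for linear inequalities *)

Fixpoint plin k (v : k.-tuple nat) (t : pterm k) : nat :=
  match t with
  | PVar i => tnth v i
  | PAdd t1 t2 => plin v t1 + plin v t2
  | _ => 0
  end.

Fixpoint pconst k (t : pterm k) : nat :=
  match t with
  | POne => 1
  | PAdd t1 t2 => pconst t1 + pconst t2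
  | _ => 0
  end.

(** A common bound for the constant of a term and for its linear part on bits, from which the
    carries are bounded. *)
Fixpoint pleaves k (t : pterm k) : nat :=
  if t is PAdd t1 t2 then pleaves t1 + pleaves t2 else 1.

Lemma pevalE k v (t : pterm k) : peval v t = pconst t + plin v t.
Proof. by elim: t => //= t1 -> t2 ->; rewrite addnACA. Qed.

Lemma pconst_le_leaves k (t : pterm k) : pconst t <= pleaves t.
Proof. by elim: t => //= t1 ? t2 ?; apply: leq_add. Qed.

Definition bits_val k (e : k.-tuple bool) : k.-tuple nat := map_tuple nat_of_bool e.

Lemma plin_bits_le_leaves k (e : k.-tuple bool) (t : pterm k) :
  plin (bits_val e) t <= pleaves t.
Proof.
elim: t => //= [i | t1 ? t2 ?]; last exact: leq_add.
by rewrite tnth_map leq_b1.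
Qed.

Lemma plin_append_bits k (e : k.-tuple bool) v (t : pterm k) :
  plin (append_bits e v) t = plin (bits_val e) t + (plin v t).*2.
Proof.
elim: t => //= [i | t1 -> t2 ->]; last by rewrite doubleD addnACA.
by rewrite tnth_append_bits tnth_map.
Qed.

(** Half of [p] is rounded down if [q] is odd, since the spare unit of [q] absorbs that of [p], and
    rounded up if [q] is even. *)
Lemma leq_add_double p q x y :
  (p + x.*2 <= q + y.*2) = ((p + ~~ odd q)./2 + x <= q./2 + y).
Proof. by case: (boolP (odd q)) => ?; lia. Qed.

(* A state (a, b) stands for a + t1 <= b + t2, where t1 and t2 denote the
   linear parts of the terms; the carries a and b stay bounded. *)
Lemma automatic_leq k (t1 t2 : pterm k) :
  automatic (fun v => peval v t1 <= peval v t2).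
Proof.
(* The final 1 makes the linear parts on bits less than [N]: added to a carry at most [N], then
   halved and rounded up, they give at most [N] again, so [inord] is exact. *)
pose N := pleaves t1 + pleaves t2 + 1.
pose carry1 (q : 'I_N.+1 * 'I_N.+1) e := q.1 + plin (bits_val e) t1.
pose carry2 (q : 'I_N.+1 * 'I_N.+1) e := q.2 + plin (bits_val e) t2.
exists ('I_N.+1 * 'I_N.+1)%type,
  (fun (q : 'I_N.+1 * 'I_N.+1) v => q.1 + plin v t1 <= q.2 + plin v t2),
  (fun e q => (inord (carry1 q e + ~~ odd (carry2 q e))./2,
               inord (carry2 q e)./2)),
  (inord (pconst t1), inord (pconst t2)).
have c1 : pconst t1 <= N by have := pconst_le_leaves t1; rewrite /N; lia.
have c2 : pconst t2 <= N by have := pconst_le_leaves t2; rewrite /N; lia.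
split=> [v | e q v] /=.
  by rewrite !pevalE !inordK.
have l1 : plin (bits_val e) t1 < N.
  by have := plin_bits_le_leaves e t1; rewrite /N; lia.
have l2 : plin (bits_val e) t2 < N.
  by have := plin_bits_le_leaves e t2; rewrite /N; lia.
have {l1} c1q : carry1 q e < N + N.
  by rewrite /carry1 -addnS leq_add // -ltnS.
have {l2} c2q : carry2 q e < N + N.
  by rewrite /carry2 -addnS leq_add // -ltnS.
rewrite !plin_append_bits !addnA -/(carry1 q e) -/(carry2 q e) leq_add_double.
by rewrite !inordK //; lia.
Qed.

Lemma automatic_pholds k (phi : pformula k) : automatic (pholds phi).
Proof.
elim: phi => {k} /= [k t1 t2|k t1 t2|k f IH|k f IHf g IHg|k f IHf g IHg
  |k f IHf g IHg|k f IH|k f IH].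
- have and_iff P P' R R' : (P <-> P') -> (R <-> R') -> (P /\ R <-> P' /\ R')
    by tauto.
  apply: automatic_ext (automatic_op2 and_iff (automatic_leq t1 t2)
                                              (automatic_leq t2 t1)) => v.
  by split=> [-> // | [le12 le21]]; apply/eqP; rewrite eqn_leq le12.
- exact: automatic_leq.
- exact: automatic_not.
- by apply: (automatic_op2 (op := and)) => //; tauto.
- by apply: (automatic_op2 (op := or)) => //; tauto.
- by apply: (automatic_op2 (op := fun P R => P -> R)) => //; tauto.
- exact: automatic_exists.
- exact: automatic_forall.
Qed.

(** * Finiteness of the kernel, and its failure for coprimality *)

Lemma automatic_kernel k (S : k.-tuple nat -> Prop) :
  automatic S ->
  exists (Q : finType) (F : Q -> k.-tuple nat -> Prop),
    forall n r, r < 2 ^ n ->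
      exists q, forall v, S (map_tuple (fun m => m * 2 ^ n + r) v) <-> F q v.
Proof.
move=> [Q [F [step [q0 [F0 Fstep]]]]]; exists Q, F => n r lt_r.
suff [q Fq] : exists q, forall v,
    F q0 (map_tuple (fun m => m * 2 ^ n + r) v) <-> F q v.
  by exists q => v; split=> [/F0/Fq | /Fq/F0].
(* The start state varies: the lowest bit of [r] is read in every coordinate, and the remaining bits
   from the state reached. *)
elim: n r lt_r q0 {F0} => [|n IHn] r lt_r q.
  exists q => v; suff -> : map_tuple (fun m => m * 2 ^ 0 + r) v = v by [].
  by apply: eq_from_tnth => i; rewrite tnth_map; lia.
have lt_r2 : r./2 < 2 ^ n by move: lt_r; rewrite expnS; lia.
have [q' Fq'] := IHn _ lt_r2 (step (nseq_tuple k (odd r)) q).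
exists q' => v; rewrite -Fq' -Fstep.
suff -> : map_tuple (fun m => m * 2 ^ n.+1 + r) v =
  append_bits (nseq_tuple k (odd r))
    (map_tuple (fun m => m * 2 ^ n + r./2) v) by [].
apply: eq_from_tnth => i; rewrite tnth_append_bits !tnth_map.
rewrite (tnth_nth false) nth_nseq ltn_ord expnS.
by rewrite mulnCA mul2n doubleD addnCA odd_double_half.
Qed.

Fixpoint odd_prime_seq i : nat :=
  s2val (prime_above (if i is j.+1 then odd_prime_seq j else 2)).

Lemma odd_prime_seq_prime i : prime (odd_prime_seq i).
Proof. by case: i => [|i] /=; case: (prime_above _). Qed.

Lemma odd_prime_seq_lt i j : i < j -> odd_prime_seq i < odd_prime_seq j.
Proof.
move: i j; apply: (homo_ltn ltn_trans) => i.
by rewrite /=; case: (prime_above _).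
Qed.

Lemma odd_prime_seq_inj : injective odd_prime_seq.
Proof.
move=> i j eq_ij; case: (ltngtP i j) => // /odd_prime_seq_lt;
  by rewrite eq_ij ltnn.
Qed.

Lemma odd_prime_seq_gt2 i : 2 < odd_prime_seq i.
Proof.
have gt0 : 2 < odd_prime_seq 0 by rewrite /=; case: (prime_above 2).
by case: i => [|i] //; apply: ltn_trans gt0 (odd_prime_seq_lt _).
Qed.

Lemma coprime_not_automatic :
  ~ automatic (fun v : 2.-tuple nat =>
      coprime (tnth v ord0).+2 (tnth v ord_max).+2).
Proof.
case/automatic_kernel=> Q [F kerF].
(* One prime more than there are states, so two of them share a state; a single [n] serves all, as
   [p i <= n < 2 ^ n]. *)
pose p (i : 'I_#|Q|.+1) := odd_prime_seq i.
pose n := \max_i p i.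
have p_sep i : exists q, forall x, coprime (p i) x <-> F q [tuple 0; x].
  have gt2 : 2 < p i := odd_prime_seq_gt2 i.
  have lt_r : p i - 2 < 2 ^ n.
    apply: leq_ltn_trans (ltn_expl n _) => //.
    by apply: leq_trans (leq_subr _ _) (leq_bigmax i).
  (* After the shift by 2 the coordinates are [p i] and [x * 2 ^ n + p i]; the summand [p i] and the
     power of 2 do not affect coprimality to the odd prime [p i]. *)
  have [q Fq] := kerF n _ lt_r; exists q => x; rewrite -Fq !tnth_map /=.
  rewrite /tnth /= mul0n add0n -addn2 subnK; last exact: ltnW.
  rewrite -addn2 -addnA subnK; last exact: ltnW.
  rewrite /coprime gcdnDr -/(coprime (p i) (x * 2 ^ n)) coprimeMr.
  have -> : coprime (p i) (2 ^ n).
    rewrite coprimeXr // prime_coprime ?odd_prime_seq_prime //.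
    by rewrite gtnNdvd.
  by rewrite andbT.
have [g gP] := fin_all_exists p_sep.
have /injectivePn[i [j neq_ij eq_g]] : ~~ injectiveb g.
  apply/negP => /injectiveP/leq_card; rewrite card_ord ltnn //.
(* The point [x = p j] separates the two sets: it is coprime to [p i] but not to [p j]. *)
have : coprime (p i) (p j).
  rewrite prime_coprime ?odd_prime_seq_prime //.
  rewrite dvdn_prime2 ?odd_prime_seq_prime //.
  by apply: contra neq_ij => /eqP/odd_prime_seq_inj/val_inj->.
move/(gP i _); rewrite eq_g => /(gP j _).
by rewrite /coprime gcdnn => /eqP p1; have := odd_prime_seq_gt2 j;
  rewrite -/(p j) p1.
Qed.

(** * Euclid's algorithm on the solutions *)

Section CentralWords.

Variable T : eqType.
Implicit Types (a b : T) (x y : seq T).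

Lemma xaby_coprime a b x y : a != b ->
  x ++ [:: a; b] ++ y = y ++ [:: b; a] ++ x -> coprime (size x).+2 (size y).+2.
Proof.
have [s] := ubnP (size x + size y).
elim: s a b x y => // s IHs a b x y lt_s neq_ab eq_xy.
(* Exchanging [x] with [y] and [a] with [b] only swaps the two sides of the equation. *)
wlog le_yx : a b x y lt_s neq_ab eq_xy / size y <= size x => [hwlog|].
  case/orP: (leq_total (size y) (size x)) => ?; first exact: (hwlog a b).
  rewrite coprime_sym; apply: (hwlog b a) => //; first by rewrite addnC.
  by rewrite eq_sym.
have def_x : x = y ++ drop (size y) x.
  rewrite -{1}(cat_take_drop (size y) x); congr (_ ++ _).
  move/(congr1 (take (size y))): eq_xy.
  by rewrite takel_cat // take_size_cat.
move: eq_xy lt_s; rewrite {}def_x; move: (drop _ _) => u {x le_yx}.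
rewrite -!catA => /(congr1 (drop (size y))).
rewrite !drop_size_cat //.
(* What remains is u a b y = b a y u. An empty [u] forces [a = b], a single letter makes the shifted
   lengths consecutive, and otherwise [u] is b a z with z a b y = y b a z. *)
case: u => [[eq_ab]|c [|d z]] /=; first by rewrite eq_ab eqxx in neq_ab.
  by move=> _ _; rewrite size_cat /= addn1 coprimeSn.
move=> [-> ->] eq_zy lt_s.
have : coprime (size z).+2 (size y).+2.
  apply: (IHs a b) => //.
  by move: lt_s; rewrite size_cat /=; lia.
rewrite size_cat /=.
have -> : (size y + (size z).+2).+2 = (size z).+2 + (size y).+2 by lia.
by rewrite ![coprime _ (size y).+2]coprime_sym /coprime gcdnDr.
Qed.

Lemma coprime_xaby a b m n : coprime m.+2 n.+2 ->
  exists x y, [/\ size x = m, size y = n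
    & x ++ [:: a; b] ++ y = y ++ [:: b; a] ++ x].
Proof.
have [s] := ubnP (m + n).
elim: s a b m n => // s IHs a b m n lt_s co_mn.
wlog lt_nm : a b m n lt_s co_mn / n < m => [hwlog|].
  case: (ltngtP m n) => [lt_mn | lt_nm | eq_mn]; last 2 first.
  - exact: hwlog.
  - by move: co_mn; rewrite eq_mn /coprime gcdnn.
  have [||x [y [sx sy eq_xy]]] := hwlog b a n m _ _ lt_mn.
  - by rewrite addnC.
  - by rewrite coprime_sym.
  by exists y, x.
move: lt_nm; rewrite leq_eqVlt => /orP[/eqP<- | lt_nm].
  (* Base case [m = n.+1]: both sides are the letter [a] between two blocks of [n.+1] letters
     [b]. *)
  exists (nseq n.+1 b), (nseq n b); rewrite !size_nseq; split=> //.
  by rewrite -{1}addn1 nseqD -catA.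
have def_m : m.+2 = (m - n.+2).+2 + n.+2 by lia.
have [||x [y [sx sy eq_xy]]] := IHs a b (m - n.+2) n.
- by lia.
- by move: co_mn; rewrite def_m ![coprime _ n.+2]coprime_sym /coprime gcdnDr.
(* Euclid's step reversed: the smaller equation turns y b a (x a b y) into y b a (y b a x). *)
exists (y ++ [:: b; a] ++ x), y; split=> //; last by rewrite -!catA eq_xy.
by rewrite !size_cat sx sy /=; lia.
Qed.

End CentralWords.

(** * The length abstraction of the equation *)

Lemma solution_flatten (A : finType) (V : eqType) (E : word_equation A V)
    (sigma : pattern A V -> seq A) : solution E sigma ->
  forall u, sigma u = flatten [seq sigma [:: s] | s <- u].
Proof. by case=> sigma0 sigmaD _ _; elim=> //= s u <-; rewrite -sigmaD. Qed.

(* true stands for x and b, false for y and a. *)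
Definition xaby_eq : word_equation bool bool :=
  WordEquation [:: inr true; inl false; inl true; inr false]
               [:: inr false; inl true; inl false; inr true].

Lemma Len_xaby_eq (v : 2.-tuple nat) :
  Len xaby_eq v <-> coprime (tnth v ord0).+2 (tnth v ord_max).+2.
Proof.
(* Last occurrences order the variables as y, x, so coordinate 0 is the length of y; hence
   [coprime_sym] in both directions. *)
split=> [[sigma sol ->] | ].
  have sigmaE := solution_flatten sol.
  case: sol => _ _ sigma_a; rewrite [LHS]sigmaE [RHS]sigmaE /= !sigma_a !cats0.
  by move/xaby_coprime=> /(_ isT); rewrite coprime_sym.
rewrite coprime_sym => /(coprime_xaby false true)[x [y [sx sy eq_xy]]].
pose sub (s : bool + bool) :=
  match s with inl a => [:: a] | inr z => if z then x else y end.
exists (fun u => flatten (map sub u)).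
  by split=> // [u w|]; rewrite ?map_cat ?flatten_cat //= !cats0.
apply: eq_from_tnth => i; rewrite !tnth_map.
by case: i => [[|[|i]] lt_i] //=; rewrite cats0 ?sx ?sy; congr tnth; apply: val_inj.
Qed.

Theorem theorem1 :
  exists (A : finType) (V : eqType) (E : word_equation A V),
    quadratic E /\ ~ presburger_definable (Len E).
Proof.
exists bool, bool, xaby_eq; split; first by case.
case=> phi phiP; apply: coprime_not_automatic.
apply: automatic_ext (automatic_pholds phi) => v.
by rewrite -phiP Len_xaby_eq.
Qed.
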